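(* Let $f\in L_2(\Omega)$, let $\psi_a\in\mathbb R$, and let $u\in\mathcal V_{0,b}$ be a solution of $$(\kappa(x,u)u',v')=(f,v)+\psi_a v(a)\quad\text{for all } v\in\mathcal V_{0,b}.$$ If $$\max_{0\le k\le n-1}|u(a_k)-u(a_{k+1})|<\frac{2k_\alpha}{L_0},$$ then $u$ is the unique solution in $\mathcal V_{0,b}$ of this discrete problem.
   Context: $\Omega=(a,b)\subset\mathbb R$ is a bounded open interval with a subdivision $a=a_0<a_1<\dots<a_{n-1}<a_n=b$, not assumed uniform. $\mathcal V_{0,b}$ is the space of continuous functions on $[a,b]$ that are affine on each interval $(a_{k-1},a_k)$, $k=1,\dots,n$, and satisfy $v(b)=0$ (no condition at $a$). Here $(u,v)=\int_\Omega uv$ and $v'=\mathrm dv/\mathrm dx$. The coefficient $\kappa:\Omega\times\mathbb R\to\mathbb R$ is a Carathéodory function (measurable in $x$ for each $s$, continuous in $s$ for a.e. $x$). There are constants $0<k_\alpha<k_\beta$ with $k_\alpha<\kappa(x,s)<k_\beta$ for all $s\in\mathbb R$ and a.e. $x\in\Omega$, and a constant $L_0>0$ with $|\kappa(x,s)-\kappa(x,t)|\le L_0|s-t|$ for all $s,t\in\mathbb R$ and a.e. $x\in\Omega$. The discrete equation is the finite element weak form of $-(\kappa(x,u)u')'=f$ in $\Omega$ with a homogeneous Dirichlet condition at $b$ and a Neumann condition at $a$ with datum $\psi_a$. *)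

(* Defs.v *)
From mathcomp Require Export all_boot all_order all_algebra.
From mathcomp Require Export all_classical all_reals all_analysis.
Export Order.TTheory GRing.Theory Num.Theory.
Export numFieldNormedType.Exports.

Set Implicit Arguments.
Unset Strict Implicit.
Unset Printing Implicit Defensive.

Local Open Scope classical_set_scope.
Local Open Scope ring_scope.

(* [R] with the Lebesgue sigma-algebra.  The library's own measurable structure
   on [R] is the Borel one, for which [x |-> kappa x (u x)] need not be
   measurable, as a Caratheodory function is only constrained almost
   everywhere. *)
Definition lebesgueR (R : realType) : measurableType _ :=
  caratheodory_type ((wlength (R := R) idfun)^*)%mu.

Definition leb (R : realType) : {measure set (lebesgueR R) -> \bar R} :=
  @completed_lebesgue_measure R.

Section DiscreteProblem.
Context {R : realType}.
Implicit Types (a b psi : R) (s : seq R) (kappa : R -> R -> R) (f u v w : R -> R).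

(* Functions on (a, b) or [a, b] are represented by functions on [R], whose
   values elsewhere are irrelevant. *)

(* Without [T := lebesgueR R], measurability would be elaborated as Borel. *)
Definition caratheodory (D : set R) kappa : Prop :=
  (forall t : R, measurable_fun (T := lebesgueR R) D (kappa ^~ t)) /\
  {ae leb R, forall x, D x -> continuous (kappa x)}.

(* [f \_ D] is [f] extended by 0 outside [D]. *)
Definition L2 (D : set R) f : Prop :=
  (f \_ D : lebesgueR R -> R) \in Lfun (leb R) 2%:E.

Definition ip a b f v : R := \int[leb R]_(x in `]a, b[) (f x * v x).

(* The points a_0 = a, ..., a_n = b, with n = size s, of the subdivision
   [itv_partition a b s]. *)
Definition knot a b s (k : nat) : R := nth b (a :: s) k.

Definition V0b a b s v : Prop :=
  [/\ {within `[a, b], continuous v},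
      forall k, (k < size s)%N -> exists c d : R,
        {in `]knot a b s k, knot a b s k.+1[, forall x, v x = c * x + d}
    & v b = 0].

(* The library derivative [derive1 v] is unspecified at the interior knots where [v]
   has a kink; they form a null set. *)
Definition discrete_solution a b s kappa f psi u : Prop :=
  V0b a b s u /\
  forall v, V0b a b s v ->
    ip a b (fun x => kappa x (u x) * derive1 u x) (derive1 v) = ip a b f v + psi * v a.

End DiscreteProblem.

(* Main.v *)
(* Testing with the function whose slope is 1 on a single element and 0 on the
   others gives U_k \int kappa(x, u) = W_k \int kappa(x, w) over that element, where
   U_k and W_k are the slopes of two solutions u and w.  If u and w agree at the
   right endpoint, then |u - w| = |U_k - W_k| (a_{k+1} - x) on the element, of
   length h, and the bounds on kappa give
   |U_k - W_k| k_alpha h <= |U_k| L0 |U_k - W_k| h^2 / 2;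
   the bound on the jump |U_k| h forces U_k = W_k.  So agreement propagates from b
   down to a. *)
From HB Require Import structures.
Require Import Defs.
From mathcomp Require Import measurable_realfun ring lra.

Set Implicit Arguments.
Unset Strict Implicit.
Unset Printing Implicit Defensive.

Local Open Scope classical_set_scope.
Local Open Scope ring_scope.

(** * Measurability of compositions with Caratheodory functions *)

(** The preimage of a set splits into countably many pieces according to the value of the index
    [i x]; on the piece for [k] it is a preimage under [F k]. *)
Lemma measurable_fun_select d d' (T : measurableType d) (S : measurableType d')
    (I : countType) (D : set T) (i : T -> I) (F : I -> T -> S) :
  measurable D -> (forall k, measurable (D `&` i @^-1` [set k])) ->
  (forall k, measurable_fun D (F k)) ->
  measurable_fun D (fun x => F (i x) x).
Proof.
move=> mD mi mF _ B mB.
rewrite (_ : _ `&` _ = \bigcup_k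
  ((D `&` i @^-1` [set k]) `&` (D `&` F k @^-1` B))); last first.
  apply/seteqP; split => [x [Dx Bx]|x [k _ [[Dx /= ->] [_ Bx]]]] //.
  by exists (i x).
apply: countable_bigcupT_measurable => // k.
by apply: measurableI => //; exact: mF.
Qed.

Lemma floor_approx_cvg (R : realType) (t : R) :
  (Num.floor (n.+1%:R * t))%:~R / n.+1%:R @[n --> \oo] --> t.
Proof.
apply/cvgrPdist_lt => e e0; near=> n.
have n0 : 0 < n.+1%:R :> R by [].
have /andP[l1 l2] : (Num.floor (n.+1%:R * t))%:~R <= n.+1%:R * t <
    (Num.floor (n.+1%:R * t) + 1)%:~R by exact: floor_itv.
have ne : n.+1%:R^-1 < e by near: n; exact: near_infty_natSinv_lt (PosNum e0).
apply: le_lt_trans ne.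
rewrite (_ : t - _ = (n.+1%:R * t - (Num.floor (n.+1%:R * t))%:~R) / n.+1%:R).
  rewrite intrD in l2; rewrite normrM normfV (gtr0_norm n0) ler_piMl ?invr_ge0//.
  by rewrite ger0_norm; lra.
by rewrite mulrBl mulrAC divff ?mul1r// gt_eqF.
Unshelve. all: by end_near. Qed.

(** Rounding [g] down to multiples of 1/(n+1) leaves countably many values, so the rounded
    compositions are measurable by [measurable_fun_select]. Continuity of [K x] makes them converge
    pointwise to [K x (g x)]. *)
Lemma measurable_fun_caratheodory_comp_pointwise d (T : measurableType d) (R : realType)
    (D : set T) (K : T -> R -> R) (g : T -> R) :
  measurable D -> (forall t, measurable_fun D (K ^~ t)) ->
  (forall x, D x -> continuous (K x)) -> measurable_fun D g ->
  measurable_fun D (fun x => K x (g x)).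
Proof.
move=> mD mK cK mg.
apply: (@measurable_fun_cvg _ _ _ D (fun n x =>
  K x ((Num.floor (n.+1%:R * g x))%:~R / n.+1%:R))) => [n|x Dx]; last first.
  by apply: continuous_cvg; [exact: cK|exact: floor_approx_cvg].
apply: (@measurable_fun_select _ _ _ _ _ D
  (fun x => Num.floor (n.+1%:R * g x)) (fun k x => K x (k%:~R / n.+1%:R))) => // k.
rewrite (_ : _ @^-1` _ = (fun x => n.+1%:R * g x) @^-1` `[k%:~R, (k + 1)%:~R[).
  by apply: measurable_funM => //; exact: measurable_cst.
apply/seteqP; split => x /=; rewrite in_itv/= -floor_eq; first by move=> ->.
by move/eqP.
Qed.

Lemma measurable_fun_null d (T : measurableType d) d' (S : measurableType d')
    (R : realType) (mu : {measure set T -> \bar R}) (N : set T) (g : T -> S) :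
  measure_is_complete mu -> measurable N -> mu N = 0%E -> measurable_fun N g.
Proof.
by move=> cmu mN N0 _ B mB; apply: cmu; exists N; split => // x [].
Qed.

(** Off the exceptional null set [N] the pointwise version applies; on [D] intersected with [N]
    every function is measurable, since completeness makes all subsets of a null set measurable. *)
Lemma measurable_fun_caratheodory_comp d (T : measurableType d) (R : realType)
    (mu : {measure set T -> \bar R}) (D : set T) (K : T -> R -> R) (g : T -> R) :
  measure_is_complete mu -> measurable D ->
  (forall t, measurable_fun D (K ^~ t)) ->
  {ae mu, forall x, D x -> continuous (K x)} -> measurable_fun D g ->
  measurable_fun D (fun x => K x (g x)).
Proof.
move=> cmu mD mK [N [mN N0 NK]] mg.
have mDN : measurable (D `&` N) by exact: measurableI.
rewrite -(setDUK (@subIsetl _ D N)) setUC; apply/measurable_funU => //.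
  exact: measurableD.
split; last first.
  apply: (measurable_fun_null _ cmu mDN).
  exact: (subset_measure0 mDN mN (@subIsetr _ D N) N0).
apply: measurable_fun_caratheodory_comp_pointwise.
- exact: measurableD.
- by move=> t; apply: measurable_funS (mK t) => //; exact: subDsetl.
- move=> x [Dx xN]; apply: contrapT => nc; apply: xN; split => //.
  by apply: NK => /(_ Dx).
- by apply: measurable_funS mg => //; exact: subDsetl.
Qed.

(** * Integrals under almost-everywhere hypotheses *)

Lemma ae_bounded_integrable d (T : measurableType d) (R : realType)
    (mu : {measure set T -> \bar R}) (D : set T) (g : T -> R) (M : R) :
  measurable D -> (mu D < +oo)%E -> measurable_fun D g ->
  {ae mu, forall x, D x -> `|g x| <= M} -> mu.-integrable D (EFin \o g).
Proof.
move=> mD Dfin mg gM; apply/integrableP; split; first exact/measurable_EFinP.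
apply: (@le_lt_trans _ _ (`|M|%:E * mu D)%E).
  apply: integral_le_bound => //; first exact/measurable_EFinP.
  apply: filterS gM => x gM Dx; rewrite lee_fin.
  exact: le_trans (gM Dx) (ler_norm M).
by rewrite lte_mul_pinfty.
Qed.

Lemma ae_le_Rintegral d (T : measurableType d) (R : realType)
    (mu : {measure set T -> \bar R}) (D : set T) (g h : T -> R) :
  measurable D -> mu.-integrable D (EFin \o g) ->
  mu.-integrable D (EFin \o h) -> {ae mu, forall x, D x -> g x <= h x} ->
  \int[mu]_(x in D) g x <= \int[mu]_(x in D) h x.
Proof.
move=> mD ig ih [N [mN N0 Ngh]]; rewrite /Rintegral.
rewrite (negligible_integral mN mD ig N0) (negligible_integral mN mD ih N0).
have mDN : measurable (D `\` N) by exact: measurableD.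
apply: le_Rintegral => //.
- by apply: integrableS ig => //; exact: subDsetl.
- by apply: integrableS ih => //; exact: subDsetl.
- move=> x [Dx xN]; apply: contrapT => gh; apply: xN; apply: Ngh.
  by move=> /(_ Dx).
Qed.

(** The measurability of [g] on [D] comes from completeness, as [g] agrees almost everywhere with
    the extension of [h] by zero. This lets [g] contain a derivative with unspecified values at
    kinks. *)
Lemma ae_Rintegral_restrict d (T : measurableType d) (R : realType)
    (mu : {measure set T -> \bar R}) (D I : set T) (g h : T -> R) :
  measure_is_complete mu -> measurable D -> measurable I -> I `<=` D ->
  measurable_fun I h -> {ae mu, forall x, D x -> (h \_ I) x = g x} ->
  \int[mu]_(x in D) g x = \int[mu]_(x in I) h x.
Proof.
move=> cmu mD mI ID mh aehg; transitivity (\int[mu]_(x in D `&` I) h x).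
  have mhI : measurable_fun D (EFin \o (h \_ I)).
    by apply/measurable_EFinP/measurable_restrict => //; rewrite setIidr.
  have ae : ae_eq mu D (EFin \o (h \_ I)) (EFin \o g).
    by apply: filterS aehg => x hg Dx; rewrite /= hg.
  rewrite Rintegral_mkcondr; congr fine; apply/esym/ae_eq_integral => //.
  exact: ae_measurable_fun ae mhI.
by rewrite setIidr.
Qed.

(** * The slope estimate on one element, seen as a set [D] of measure [h] with coordinate [X] and
    right end [r] *)

Section element.
Context d (T : measurableType d) (R : realType) (mu : {measure set T -> \bar R})
  (D : set T) (X : T -> R) (K : T -> R -> R) (ka kb L r h : R)
  (cmu : measure_is_complete mu) (mD : measurable D)
  (h0 : 0 < h) (muD : mu D = h%:E) (mX : measurable_fun D X)
  (Xr : forall x, D x -> 0 <= r - X x <= h)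
  (intX : \int[mu]_(x in D) (r - X x) = h ^+ 2 / 2)
  (mK : forall t, measurable_fun D (K ^~ t))
  (cK : {ae mu, forall x, D x -> continuous (K x)})
  (bK : {ae mu, forall x, D x -> forall t, ka < K x t < kb})
  (lipK : {ae mu, forall x, D x ->
     forall t1 t2, `|K x t1 - K x t2| <= L * `|t1 - t2|}).

Lemma measurable_affine_comp c e : measurable_fun D (fun x => K x (c * X x + e)).
Proof.
apply: measurable_fun_caratheodory_comp cK _ => //.
by apply: measurable_funD => //; exact: measurable_funM.
Qed.

Let Dfin : (mu D < +oo)%E. Proof. by rewrite muD ltry. Qed.

Lemma integrable_affine_comp c e :
  mu.-integrable D (EFin \o (fun x => K x (c * X x + e))).
Proof.
(* No sign is assumed for [ka] and [kb] here; this sum bounds the absolute value of anything between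
   them. *)
apply: (@ae_bounded_integrable _ _ _ _ _ _ (`|ka| + `|kb|)) => //.
  exact: measurable_affine_comp.
apply: filterS bK => x /[apply] /(_ (c * X x + e)) /andP[k1 k2].
have := ler_norm kb; have := ler_norm (- ka); rewrite normrN => ? ?.
have := normr_ge0 ka; have := normr_ge0 kb => ? ?.
rewrite ler_norml; apply/andP; split; lra.
Qed.

(** With P and Q the two integrals, the flux identity reads c (P - Q) = (c' - c) Q. The Lipschitz
    bound controls P - Q and the lower bound on [K] controls Q, so smallness is required of [c]
    alone: the competing solution may have arbitrary jumps. *)
Lemma affine_slope_unique c e c' e' : 0 < ka -> 0 < L ->
  c * r + e = c' * r + e' ->
  c * \int[mu]_(x in D) K x (c * X x + e) =
    c' * \int[mu]_(x in D) K x (c' * X x + e') ->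
  `|c * h| < 2 * ka / L ->
  c = c'.
Proof.
move=> ka0 L0 ce fluxE jump.
have iu := integrable_affine_comp c e; have iw := integrable_affine_comp c' e'.
set P := Rintegral _ _ _ in fluxE; set Q := Rintegral _ _ _ in fluxE.
have ilin : mu.-integrable D (EFin \o (fun x => r - X x)).
  apply: (@ae_bounded_integrable _ _ _ _ _ _ h) => //.
    exact: measurable_funB.
  by apply: aeW => x /Xr /andP[? ?]; rewrite ger0_norm.
have Qge : ka * h <= Q.
  rewrite -[h in ka * h]/(fine h%:E) -muD -Rintegral_cst//.
  apply: ae_le_Rintegral => //.
  - by apply: (@ae_bounded_integrable _ _ _ _ _ _ `|ka|) => //; exact: aeW.
  - by apply: filterS bK => x /[apply] /(_ (c' * X x + e')) /andP[/ltW].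
have PQ : `|P - Q| <= L * `|c - c'| * (h ^+ 2 / 2).
  rewrite /P /Q -RintegralB// -intX.
  have iPQ : mu.-integrable D
      (EFin \o (fun x => K x (c * X x + e) - K x (c' * X x + e'))).
    exact: integrableB iu iw.
  apply: le_trans (le_normr_Rintegral _ _) _ => //.
  rewrite -RintegralZl//; apply: ae_le_Rintegral => //.
  - exact: integrable_norm.
  - exact: integrableZl ilin.
  - apply: filterS lipK => x lip Dx; apply: le_trans (lip Dx _ _) _.
    (* The two affine functions agree at [r], so their difference is a multiple of [r - X]. Its
       integral h^2 / 2, rather than the cruder h^2, is what yields the factor 2 in the
       threshold. *)
    rewrite -mulrA ler_pM2l// (_ : _ - _ = (c' - c) * (r - X x)); last by lra.
    by have /andP[rX _] := Xr Dx; rewrite normrM distrC (ger0_norm rX).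
apply/eqP; rewrite -subr_eq0; apply/negPn/negP => cc0.
have n0 : 0 < `|c - c'| by rewrite normr_gt0.
have E1 : `|c| * `|P - Q| = `|c - c'| * Q.
  have Q0 : 0 <= Q by apply: le_trans Qge; rewrite mulr_ge0// ltW.
  rewrite -[Q in RHS]ger0_norm// -!normrM -[RHS]normrN; congr `|_|.
  by rewrite mulrBr fluxE; ring.
have E2 : `|c - c'| * (ka * h) <= `|c| * (L * `|c - c'| * (h ^+ 2 / 2)).
  apply: (@le_trans _ _ (`|c - c'| * Q)); first by rewrite ler_wpM2l.
  by rewrite -E1 ler_wpM2l.
move: jump; rewrite normrM (gtr0_norm h0) ltr_pdivlMr// => jump.
suff : 2 * ka <= `|c| * h * L by rewrite leNgt jump.
(* Multiplied by this positive factor, the goal becomes [E2]. *)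
rewrite -(@ler_pM2l _ (`|c - c'| * h / 2)) ?divr_gt0 ?mulr_gt0//.
by lra.
Qed.

End element.

(** * Lebesgue measure on the Lebesgue and on the Borel sigma-algebra *)

Lemma lebesgueR_measurable (R : realType) (A : set R) :
  measurable A -> measurable (A : set (lebesgueR R)).
Proof. exact: sub_caratheodory. Qed.

Lemma lebesgueR_measurable_itv (R : realType) (i : interval R) :
  measurable ([set` i] : set (lebesgueR R)).
Proof. by apply: lebesgueR_measurable; exact: measurable_itv. Qed.

Lemma lebesgueR_measurable_set1 (R : realType) (x : R) :
  measurable ([set x] : set (lebesgueR R)).
Proof. by apply: lebesgueR_measurable; exact: measurable_set1. Qed.

Lemma measurable_idR (R : realType) :
  measurable_fun (T := lebesgueR R) setT (idfun : lebesgueR R -> measurableTypeR R).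
Proof. by move=> _ A mA; rewrite setTI; exact: lebesgueR_measurable. Qed.

Lemma leb_itv (R : realType) (a b : R) : a < b ->
  leb R [set` `]a, b[] = (b - a)%:E.
Proof.
move=> ab; transitivity (@lebesgue_measure R [set` `]a, b[]) => //.
by rewrite lebesgue_measure_itv /= lte_fin ab.
Qed.

Lemma leb_set1 (R : realType) (a : R) : leb R [set a] = 0%E.
Proof. exact: lebesgue_measure_set1. Qed.

(** The identity, measurable from the Lebesgue to the Borel structure, pushes [leb R] forward to the
    Borel Lebesgue measure, so this is a change of variables. It gives access to the fundamental
    theorem of calculus. *)
Lemma leb_integral_borel (R : realType) (D : set R) (f : R -> \bar R) :
  measurable (D : set (measurableTypeR R)) ->
  measurable_fun (D : set (measurableTypeR R)) f -> {in D, forall y, (0 <= f y)%E} ->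
  (\int[leb R]_(x in D) f x = \int[lebesgue_measure]_(x in D) f x)%E.
Proof.
move=> mD mf f0.
have mid := isMeasurableFun.Build _ _ _ _ _ (@measurable_idR R).
pose phi : {mfun lebesgueR R >-> measurableTypeR R} :=
  HB.pack (idfun : lebesgueR R -> measurableTypeR R) mid.
have E := ge0_integral_pushforward (@measurable_idR R) (leb R) mD mf f0.
rewrite -[LHS]E.
exact: (@eq_measure_integral _ (measurableTypeR R) R D lebesgue_measure
  (pushforward (leb R) phi) f).
Qed.

Lemma leb_Rintegral_linear (R : realType) (a b : R) : a < b ->
  \int[leb R]_(x in [set` `]a, b[]) (b - x) = (b - a) ^+ 2 / 2.
Proof.
move=> ab; rewrite /Rintegral leb_integral_borel; first last.
- by move=> x; rewrite inE/= in_itv/= lee_fin subr_ge0 => /andP[_ /ltW].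
- apply/measurable_EFinP; apply: measurable_funB => //.
- exact: measurable_itv.
have cf : continuous (fun x : R => b - x).
  by move=> x; apply: cvgB; [exact: cvg_cst|exact: cvg_id].
pose F x : R := - ((b - x) ^+ 2 / 2).
have dF (x : R) : is_derive x (1 : R) F (b - x).
  rewrite /F; apply: is_derive_eq.
  by rewrite !scaler0 /GRing.scale/= !add0r; field.
have cF : continuous F.
  by move=> x; apply/differentiable_continuous/derivable1_diffP/ex_derive.
(* The endpoints are null, so the interval may be closed before applying the fundamental theorem. *)
rewrite integral_itv_obnd_cbnd; last first.
  by apply/measurable_EFinP; apply: measurable_funB.
rewrite integral_itv_bndo_bndc; last first.
  by apply/measurable_EFinP; apply: measurable_funB.
rewrite (@continuous_FTC2 R (fun x => b - x) F)//=.
- by rewrite /F; field.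
- exact: continuous_subspaceT.
- by split => [x _||]; [exact: ex_derive
    |apply: cvg_at_right_filter; exact: cF|apply: cvg_at_left_filter; exact: cF].
- by move=> x _; rewrite derive1E derive_val.
Qed.

(** * Affine pieces and ramp test functions *)

Lemma derive1_near_affine (R : realType) (v : R -> R) (c d x : R) :
  (\near x, v x = c * x + d) -> derive1 v x = c.
Proof.
move=> vE; rewrite derive1E (near_eq_derive _ vE).
have h : is_derive x (1 : R) (fun y : R => c * y + d) c.
  by apply: is_derive_eq; rewrite addr0 /GRing.scale/= mulr1.
exact: derive_val.
Qed.

Lemma derive1_itv_affine (R : realType) (v : R -> R) (a b c d x : R) :
  {in `]a, b[, forall y, v y = c * y + d} -> x \in `]a, b[ -> derive1 v x = c.
Proof.
move=> vE xab; apply: (@derive1_near_affine _ _ _ d).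
by near=> y; apply: vE; near: y; exact: near_in_itvoo.
Unshelve. all: by end_near. Qed.

(** For [a < b], the primitive of the indicator of (a, b) that vanishes to the right of [b]. Here
    [a] and [b] are the ends of one element; this choice of constant secures the Dirichlet condition
    at the end of the domain. *)
Definition ramp {R : realType} (a b x : R) : R := Num.max a (Num.min x b) - b.

Lemma ramp_lt (R : realType) (a b x : R) : a < b -> x <= a -> ramp a b x = a - b.
Proof.
move=> ab xa; rewrite /ramp; congr (_ - _); apply/max_idPl.
by rewrite ge_min xa.
Qed.

Lemma ramp_gt (R : realType) (a b x : R) : a < b -> b <= x -> ramp a b x = 0.
Proof.
move=> ab bx; rewrite /ramp; apply/eqP; rewrite subr_eq0 (min_idPr bx).
by apply/eqP/max_idPr/ltW.
Qed.

Lemma ramp_mid (R : realType) (a b x : R) : a <= x <= b -> ramp a b x = x - b.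
Proof.
by move=> /andP[ax xb]; rewrite /ramp (min_idPl xb) (max_idPr ax).
Qed.

Lemma ramp_continuous (R : realType) (a b : R) : continuous (ramp a b).
Proof.
move=> x; apply: cvgB; last exact: cvg_cst.
apply: (continuous_max (f := cst a) (g := fun x => Num.min x b)).
  exact: cvg_cst.
by apply: (continuous_min (f := idfun) (g := cst b)); [exact: cvg_id|exact: cvg_cst].
Qed.

Lemma derive1_ramp_lt (R : realType) (a b x : R) :
  a < b -> x < a -> derive1 (ramp a b) x = 0.
Proof.
move=> ab xa; apply: (@derive1_near_affine _ _ _ (a - b)).
near=> y; rewrite mul0r add0r ramp_lt//.
by apply/ltW; near: y; exact: lt_nbhsl.
Unshelve. all: by end_near. Qed.

Lemma derive1_ramp_gt (R : realType) (a b x : R) :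
  a < b -> b < x -> derive1 (ramp a b) x = 0.
Proof.
move=> ab xa; apply: (@derive1_near_affine _ _ _ 0).
near=> y; rewrite mul0r add0r ramp_gt//.
by apply/ltW; near: y; exact: lt_nbhsr.
Unshelve. all: by end_near. Qed.

Lemma derive1_ramp_mid (R : realType) (a b x : R) :
  x \in `]a, b[ -> derive1 (ramp a b) x = 1.
Proof.
apply: (@derive1_itv_affine _ _ _ _ _ (- b)) => y.
by rewrite in_itv/= mul1r => /andP[ay yb]; rewrite ramp_mid// !ltW.
Qed.

(** Membership in [V0b] gives affine formulas on open elements only. Uniqueness of one-sided limits
    carries them to the knots, where neighbouring elements are compared. *)
Lemma affine_itv_closure (R : realType) (v : R -> R) (l r c d : R) : l < r ->
  {within `[l, r], continuous v} ->
  {in `]l, r[, forall x, v x = c * x + d} ->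
  {in `[l, r], forall x, v x = c * x + d}.
Proof.
move=> lr /(continuous_within_itvP _ lr)[_ vl vr] vE x.
have ca (y : R) : c * x + d @[x --> y] --> c * y + d.
  by apply: cvgD (cvg_cst d); apply: cvgM (cvg_cst c) cvg_id.
rewrite in_itv/= le_eqVlt [x <= r]le_eqVlt => /andP[/predU1P[<-{x} _|lx]].
  apply: (cvg_unique _ vl) => //=.
  apply: (cvg_trans _ (cvg_at_right_filter (ca l))).
  apply: near_eq_cvg; near=> y; apply/esym/vE; rewrite in_itv/=.
  apply/andP; split; near: y.
    exact: nbhs_right_gt.
  exact: nbhs_right_lt.
move=> /predU1P[->{x lx}|xr]; last by rewrite vE// in_itv/= lx.
apply: (cvg_unique _ vr) => //=.
apply: (cvg_trans _ (cvg_at_left_filter (ca r))).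
apply: near_eq_cvg; near=> y; apply/esym/vE; rewrite in_itv/=.
apply/andP; split; near: y.
  exact: nbhs_left_gt.
exact: nbhs_left_lt.
Unshelve. all: by end_near. Qed.

(** * The subdivision and its ramps *)

Section knots.
Context (R : realType) (a b : R) (s : seq R) (hs : itv_partition a b s).

Lemma knot_lt j k : (j < k <= size s)%N -> knot a b s j < knot a b s k.
Proof.
case: hs => ps _ /andP[jk ks]; apply: (sorted_ltn_nth lt_trans) => //.
by rewrite inE/= ltnS (leq_trans (ltnW jk)).
Qed.

Lemma knot_le j k : (j <= k <= size s)%N -> knot a b s j <= knot a b s k.
Proof.
move=> /andP[]; rewrite leq_eqVlt => /predU1P[->//|jk] ks.
by apply/ltW/knot_lt; rewrite jk.
Qed.

Lemma knot_size : knot a b s (size s) = b.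
Proof. exact: itv_partition_nth_size. Qed.

Lemma knot_bounds k : (k <= size s)%N -> a <= knot a b s k <= b.
Proof.
move=> ks; rewrite -{3}knot_size knot_le ?leqnn ?andbT//.
by rewrite -[X in X <= _]/(knot a b s 0) knot_le.
Qed.

Lemma knot_itv x : a < b -> a <= x <= b ->
  exists2 k, (k < size s)%N & knot a b s k <= x <= knot a b s k.+1.
Proof.
move=> ab /andP[ax xb].
have s0 : (0 < size s)%N.
  rewrite lt0n; apply/eqP => s0; move: ab.
  by rewrite -knot_size s0 ltxx.
have ex : exists k, x <= knot a b s k by exists (size s); rewrite knot_size.
(* The least index of a knot at or beyond [x] closes the wanted element. Index 0 forces [x = a],
   which lies in element 0; otherwise minimality against the last knot [b] gives [k < size s]. *)
case: (ex_minnP ex) => -[|k] xk kmin.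
  exists 0%N => //; rewrite [knot _ _ _ 0]/= ax/=.
  by rewrite (le_trans xk)// knot_le.
exists k.
  by apply: kmin; rewrite knot_size.
by rewrite xk andbT leNgt; apply/negP => /ltW /kmin; rewrite ltnn.
Qed.

(** The kinks sit at two consecutive knots, so every element lies to the left of the ramp, to its
    right, or is the one on which it rises. *)
Lemma V0b_ramp k : (k < size s)%N ->
  V0b a b s (ramp (knot a b s k) (knot a b s k.+1)).
Proof.
move=> ks; have kk : knot a b s k < knot a b s k.+1 by rewrite knot_lt// ltnSn.
split.
- by apply: continuous_subspaceT; exact: ramp_continuous.
- move=> j js; have [jk|kj|->] := ltngtP j k.
  + exists 0, (knot a b s k - knot a b s k.+1) => x.
    rewrite in_itv/= mul0r add0r => /andP[_ xj]; rewrite ramp_lt//.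
    by rewrite (le_trans (ltW xj))// knot_le// jk ltnW.
  + exists 0, 0 => x.
    rewrite in_itv/= mul0r add0r => /andP[jx _]; rewrite ramp_gt//.
    by rewrite (le_trans _ (ltW jx))// knot_le// kj ltnW.
  + exists 1, (- knot a b s k.+1) => x.
    by rewrite in_itv/= mul1r => /andP[? ?]; rewrite ramp_mid// !ltW.
- by rewrite ramp_gt//; have /andP[] := knot_bounds ks.
Qed.

End knots.

(** * Testing the equation on one element *)

Lemma leb_ae_neq (R : realType) (c : R) : {ae leb R, forall x, x != c}.
Proof.
exists [set c]; split; [exact: lebesgueR_measurable_set1|exact: leb_set1|].
by move=> x /= /negP; rewrite negbK => /eqP.
Qed.

(* By completeness, the unspecified values of the derivative at the two kinks do
   not affect measurability. *)
Lemma ip_ramp (R : realType) (a b l r : R) (h : R -> R) :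
  a <= l -> l < r -> r <= b ->
  measurable_fun (T := lebesgueR R) [set` `]l, r[] h ->
  ip a b h (derive1 (ramp l r)) = \int[leb R]_(x in [set` `]l, r[]) h x.
Proof.
move=> al lr rb.
have aeF : Filter (almost_everywhere (leb R)) by exact: ae_filter_ringOfSetsType.
have IJ : [set` `]l, r[] `<=` [set` `]a, b[].
  by apply: subset_itv; rewrite bnd_simp.
have rampE : {ae leb R, forall x, [set` `]a, b[] x ->
    (h \_ [set` `]l, r[]) x = h x * derive1 (ramp l r) x}.
  apply: filterS2 (leb_ae_neq l) (leb_ae_neq r) => x xl xr _.
  rewrite patchE mem_setE in_itv/=.
  case: (ltgtP l x) xl => // lx _; last by rewrite derive1_ramp_lt ?mulr0.
  case: (ltgtP x r) xr => // xr _; last by rewrite derive1_ramp_gt ?mulr0.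
  by rewrite derive1_ramp_mid ?mulr1// in_itv/= lx.
move=> mh; exact: (ae_Rintegral_restrict
  (@completed_lebesgue_measure_is_complete R)
  (lebesgueR_measurable_itv _) (lebesgueR_measurable_itv _) IJ mh rampE).
Qed.

(** Reduces to [affine_slope_unique] with the identity as coordinate: the hypotheses on [kappa]
    restrict from (a, b) to (l, r), and testing with the ramp isolates the flux through this
    element. *)
Lemma element_slopes_eq (R : realType) (a b l r : R) (kappa : R -> R -> R)
    (k_alpha k_beta L0 c e c' e' : R) (u w : R -> R) :
  a <= l -> l < r -> r <= b ->
  caratheodory `]a, b[ kappa ->
  {ae leb R, forall x, x \in `]a, b[ -> forall t, k_alpha < kappa x t < k_beta} ->
  {ae leb R, forall x, x \in `]a, b[ ->
     forall t1 t2, `|kappa x t1 - kappa x t2| <= L0 * `|t1 - t2|} ->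
  0 < k_alpha -> 0 < L0 ->
  {in `]l, r[, forall x, u x = c * x + e} ->
  {in `]l, r[, forall x, w x = c' * x + e'} ->
  c * r + e = c' * r + e' ->
  ip a b (fun x => kappa x (u x) * derive1 u x) (derive1 (ramp l r)) =
    ip a b (fun x => kappa x (w x) * derive1 w x) (derive1 (ramp l r)) ->
  `|c * (r - l)| < 2 * k_alpha / L0 ->
  c = c'.
Proof.
move=> al lr rb [mkappa ckappa] hbound hlip ka0 L0_gt0.
have aeF : Filter (almost_everywhere (leb R)) by exact: ae_filter_ringOfSetsType.
have IJ : [set` `]l, r[] `<=` [set` `]a, b[].
  by apply: subset_itv; rewrite bnd_simp.
have cK : {ae leb R, forall x, [set` `]l, r[] x -> continuous (kappa x)}.
  by apply: filterS ckappa => x h /IJ; exact: h.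
have bK : {ae leb R, forall x, [set` `]l, r[] x ->
    forall t, k_alpha < kappa x t < k_beta}.
  by apply: filterS hbound => x h /IJ; exact: h.
have lipK : {ae leb R, forall x, [set` `]l, r[] x ->
    forall t1 t2, `|kappa x t1 - kappa x t2| <= L0 * `|t1 - t2|}.
  by apply: filterS hlip => x h /IJ; exact: h.
have Xr x : [set` `]l, r[] x -> 0 <= r - x <= r - l.
  by rewrite /= in_itv/= => /andP[? ?]; apply/andP; split; lra.
have h0 : 0 < r - l by rewrite subr_gt0.
have cmu := @completed_lebesgue_measure_is_complete R.
have mI := lebesgueR_measurable_itv `]l, r[.
have mX : measurable_fun (T := lebesgueR R) [set` `]l, r[] (fun x : R => x).
  exact: measurable_funTS (@measurable_idR R).
have mK t : measurable_fun (T := lebesgueR R) [set` `]l, r[] (kappa ^~ t) :=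
  measurable_funS (lebesgueR_measurable_itv `]a, b[) IJ (mkappa t).
(* On (l, r) the derivative of [v] is the constant [c0], which leaves the integral; this is stated
   for a generic [v] so as to serve both [u] and [w]. *)
have flux (c0 e0 : R) (v : R -> R) : {in `]l, r[, forall x, v x = c0 * x + e0} ->
    ip a b (fun x => kappa x (v x) * derive1 v x) (derive1 (ramp l r)) =
    c0 * \int[leb R]_(x in [set` `]l, r[]) kappa x (c0 * x + e0).
  move=> vE.
  have hE : {in [set` `]l, r[], (fun x => c0 * kappa x (c0 * x + e0)) =1
      (fun x => kappa x (v x) * derive1 v x)}.
    move=> x; rewrite mem_setE => xI.
    by rewrite (derive1_itv_affine vE xI) (vE _ xI) mulrC.
  have mh := measurable_funM (@measurable_cst _ _ (lebesgueR R) R _ c0)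
    (measurable_affine_comp cmu mI mX mK cK c0 e0).
  have mh' := @eq_measurable_fun _ _ (lebesgueR R) R _ _ _ hE mh.
  have iK := integrable_affine_comp cmu mI (leb_itv lr) mX mK cK bK c0 e0.
  rewrite (ip_ramp al lr rb mh').
  transitivity (\int[leb R]_(x in [set` `]l, r[])
      (c0 * kappa x (c0 * x + e0))).
    by apply: eq_Rintegral => x xI; rewrite -(hE x xI).
  exact: RintegralZl mI iK.
move=> uE wE cer; rewrite (flux _ _ _ uE) (flux _ _ _ wE) => fluxE jump.
exact: (affine_slope_unique cmu mI h0 (leb_itv lr) mX Xr
  (leb_Rintegral_linear lr) mK cK bK lipK ka0 L0_gt0 cer fluxE jump).
Qed.

(** * Propagation of agreement from b down to a *)

Theorem corollary2p5 (R : realType) (a b : R) (hab : a < b)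
    (s : seq R) (hs : itv_partition a b s)
    (kappa : R -> R -> R) (hkappa : caratheodory `]a, b[ kappa)
    (k_alpha k_beta : R) (hk_alpha : 0 < k_alpha) (hk_beta : k_alpha < k_beta)
    (hbound : {ae leb R, forall x, x \in `]a, b[ ->
       forall t : R, k_alpha < kappa x t < k_beta})
    (L0 : R) (hL0 : 0 < L0)
    (hlip : {ae leb R, forall x, x \in `]a, b[ ->
       forall t1 t2 : R, `|kappa x t1 - kappa x t2| <= L0 * `|t1 - t2|})
    (f : R -> R) (hf : L2 `]a, b[ f) (psi_a : R)
    (u : R -> R) (hu : discrete_solution a b s kappa f psi_a u)
    (hjump : \big[Num.max/0]_(k < size s)
       `|u (knot a b s k) - u (knot a b s k.+1)| < 2 * k_alpha / L0) :
  forall w : R -> R, discrete_solution a b s kappa f psi_a w ->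
    {in `[a, b], forall x, w x = u x}.
Proof.
move=> w hw; case: hu hw => [[uc ua ub] uE] [[wc wa wb] wE].
(* Agreement at the right knot of an element spreads to the whole closed element, hence to its left
   knot. *)
have step k : (k < size s)%N -> w (knot a b s k.+1) = u (knot a b s k.+1) ->
    {in `[knot a b s k, knot a b s k.+1], forall x, w x = u x}.
  move=> ks.
  have lr : knot a b s k < knot a b s k.+1 by rewrite (knot_lt hs)// ltnSn.
  have /andP[al _] := knot_bounds hs (ltnW ks).
  have /andP[_ rb] := knot_bounds hs ks.
  have [cu [du uk]] := ua _ ks; have [cw [dw wk]] := wa _ ks.
  have jump := le_lt_trans (le_bigmax 0 (fun k : 'I_(size s) =>
    `|u (knot a b s k) - u (knot a b s k.+1)|) (Ordinal ks)) hjump.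
  move: lr al rb uk wk jump (V0b_ramp hs ks) => /=.
  set l := knot a b s k; set r := knot a b s k.+1.
  move=> lr al rb uk wk jump ramp_V0b wur.
  have subab : `[l, r] `<=` `[a, b] by apply: subset_itv; rewrite bnd_simp.
  have uk' := affine_itv_closure lr (continuous_subspaceW subab uc) uk.
  have wk' := affine_itv_closure lr (continuous_subspaceW subab wc) wk.
  have rr : r \in `[l, r] by rewrite in_itv/= lexx ltW.
  have ll : l \in `[l, r] by rewrite in_itv/= lexx ltW.
  have cer : cu * r + du = cw * r + dw by rewrite -uk'// -wk'.
  have hjump_k : `|cu * (r - l)| < 2 * k_alpha / L0.
    (* Slope times length is the jump of [u], by the affine formula extended to both end knots. *)
    rewrite (_ : cu * (r - l) = - (u l - u r)) ?normrN//.
    by rewrite !uk'//; ring.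
  (* Both solutions have the same right-hand side for the ramp, so the terms in [f] and [psi_a]
     cancel and the tested fluxes coincide. *)
  have sl : cu = cw := element_slopes_eq al lr rb hkappa hbound hlip hk_alpha hL0
    uk wk cer (etrans (uE _ ramp_V0b) (esym (wE _ ramp_V0b))) hjump_k.
  move=> x xlr; rewrite wk'// uk'// sl; congr (_ + _).
  by move: cer; rewrite sl => /addrI.
have knots k : (k <= size s)%N -> w (knot a b s k) = u (knot a b s k).
  (* Descending induction on the knot index, run as induction on [size s - k]; the base case is the
     Dirichlet condition at [b]. *)
  move=> ks; rewrite -(subKn ks).
  elim: (size s - k)%N (leq_subr k (size s)) => [_|j ih js].
    by rewrite subn0 (knot_size hs) wb ub.
  have ks' : (size s - j.+1 < size s)%N by rewrite ltn_subrL (leq_trans _ js).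
  have E : ((size s - j.+1).+1 = size s - j)%N by rewrite subnSK.
  apply: (step _ ks'); first by rewrite E ih// ltnW.
  by rewrite in_itv/= lexx ltW// (knot_lt hs)// ltnSn.
move=> x; rewrite in_itv/= => xab.
have [k ks xk] := knot_itv hs hab xab.
by apply: (step k ks (knots _ ks)); rewrite in_itv.
Qed.
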